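(* Let $G=(V,E)$ be a graph. For any OS-set $S$ of $G$, $V\setminus S$ is a positive semidefinite zero forcing set for $G$; and for any positive semidefinite zero forcing set $X$ for $G$, there is an ordering of the vertices of $V\setminus X$ that makes $V\setminus X$ an OS-set of $G$. Thus $\mathrm{Z}_+(G)+\mathrm{OS}(G)=|G|$, where $|G|=|V|$.
   Context: A graph $G=(V,E)$ is a finite simple undirected graph with nonempty vertex set. Positive semidefinite color change rule: let $B$ be the set of all currently black vertices (all other vertices are white), and let $W_1,\dots,W_k$ be the vertex sets of the connected components of $G-B$ (possibly $k=1$). If $u\in B$, $w\in W_i$, and $w$ is the only white neighbor of $u$ in the induced subgraph $G[W_i\cup B]$, then change the color of $w$ to black. A positive semidefinite zero forcing set is a set $X\subseteq V$ such that, starting with exactly the vertices of $X$ black and applying this rule repeatedly (recomputing $B$ and the components each time) until no more changes are possible, all vertices become black. $\mathrm{Z}_+(G)$ is the minimum of $|X|$ over all positive semidefinite zero forcing sets $X$. Let $S=(v_1,\dots,v_m)$ be an ordered subset of (distinct) vertices of $G$. For $1\le k\le m$ let $G_k$ be the subgraph of $G$ induced by $\{v_1,\dots,v_k\}$ and let $H_k$ be the connected component of $G_k$ containing $v_k$. $S$ is an OS-set (ordered set of vertices) if for each $k$ there exists a vertex $w_k$ of $G$ with $w_k\neq v_l$ for all $l\le k$, $\{w_k,v_k\}\in E$, and $\{w_k,v_s\}\notin E$ for all $v_s$ in $H_k$ with $s\neq k$. The empty sequence ($m=0$) is vacuously an OS-set. $\mathrm{OS}(G)$ is the maximum of $|S|$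 over all OS-sets $S$ of $G$. *)

(* Defs.v *)
From mathcomp Require Import all_boot.

Set Implicit Arguments.
Unset Strict Implicit.
Unset Printing Implicit Defensive.

(* A simple graph on the vertex type T is given by its adjacency relation
   e : rel T, assumed symmetric and irreflexive where it is used. *)
Section PsdZeroForcing.

Variables (T : finType) (e : rel T).
Implicit Types (A B W X : {set T}) (s : seq T).

Definition induced A : rel T := [rel x y | [&& x \in A, y \in A & e x y]].

Definition component A x : {set T} := [set y in A | connect (induced A) x y].

Definition components A : {set {set T}} := [set component A x | x in A].

Definition white_neighbors B W u : {set T} :=
  [set x in ~: B | induced (W :|: B) u x].

Definition psd_force B u w : bool :=
  (u \in B) &&
  [exists W in components (~: B),
    (w \in W) && (white_neighbors B W u == [set w])].

Definition psd_step : rel {set T} :=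
  [rel B B' | [exists u, exists w, psd_force B u w && (B' == w |: B)]].

(* No step leaves [set: T], so reaching it means that the process stops there;
   psd_zfsP below shows that the order of the steps is irrelevant. *)
Definition psd_zfs X : bool := connect psd_step X [set: T].

(* The default [set: T] is itself a psd zero forcing set. *)
Definition Zplus : nat := #|[arg min_(X < [set: T] | psd_zfs X) #|X| ]|.

(* With 0-based k, v_k is the k-th entry of s, and A = {v_0, ..., v_k}. *)
Definition OS_set s : bool :=
  uniq s &&
  [forall k : 'I_(size s),
    let v := tnth (in_tuple s) k in
    let A := [set x in take k.+1 s] in
    [exists w, [&& w \notin A, e w v
      & [forall x in component A v, (x != v) ==> ~~ e w x]]]].

(* An OS-set has distinct entries, so its length is at most #|T|. *)
Definition OS : nat :=
  \max_(m < #|T|.+1 | [exists s : m.-tuple T, OS_set s]) m.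

Lemma psd_zfs_setT : psd_zfs [set: T].
Proof. exact: connect0. Qed.

Lemma ZplusP :
  (exists2 X, psd_zfs X & #|X| = Zplus) /\
  (forall X, psd_zfs X -> Zplus <= #|X|).
Proof.
rewrite /Zplus; case: arg_minnP => [|X zX minX]; first exact: psd_zfs_setT.
by split=> //; exists X.
Qed.

Lemma OS_P :
  (exists2 s, OS_set s & size s = OS) /\
  (forall s, OS_set s -> size s <= OS).
Proof.
have nilP : [exists s : (ord0 : 'I_#|T|.+1).-tuple T, OS_set s].
  by apply/existsP; exists [tuple]; apply/forallP => -[].
split.
  rewrite /OS (bigmax_eq_arg ord0) //.
  case: arg_maxnP => // m /existsP[s Os] _.
  by exists s; rewrite ?size_tuple.
move=> s Os; have /andP[Us _] := Os.
have sz : size s < #|T|.+1 by rewrite ltnS -(card_uniqP Us) max_card.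
apply: (@leq_bigmax_cond _ _ (fun m : 'I_#|T|.+1 => m : nat) (Ordinal sz)).
by apply/existsP; exists (in_tuple s).
Qed.

Lemma induced_connectS A B x y :
  A \subset B -> connect (induced A) x y -> connect (induced B) x y.
Proof.
move=> /subsetP sAB; apply: connect_sub => u v /and3P[uA vA uv].
by apply/connect1/and3P; split=> //; apply: sAB.
Qed.

Lemma in_white_neighbors B W u x : u \in B ->
  (x \in white_neighbors B W u) = [&& x \notin B, x \in W & e u x].
Proof.
move=> uB; rewrite !inE /induced /= !in_setU uB orbT /=.
by case: (x \in B); rewrite ?orbF.
Qed.

Lemma psd_force_mono B B' u w :
  B \subset B' -> psd_force B u w -> w \notin B' -> psd_force B' u w.
Proof.
move=> sBB' /andP[uB /exists_inP[_ /imsetP[z zB ->] /andP[wz /eqP Ew]]] wB'.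
have sC : ~: B' \subset ~: B by rewrite setCS.
have uB' := subsetP sBB' _ uB.
rewrite /psd_force uB' /=; apply/exists_inP.
exists (component (~: B') w); first by apply: imset_f; rewrite inE.
have ww : w \in component (~: B') w by rewrite !inE wB' connect0.
rewrite ww /=; apply/eqP/setP => x; rewrite in_white_neighbors //.
have /and3P[_ _ uw] : [&& w \notin B, w \in component (~: B) z & e u w].
  by rewrite -in_white_neighbors // Ew set11.
apply/idP/set1P => [/and3P[xB' xW ux] | ->]; last by rewrite wB' ww uw.
have xB : x \notin B by apply: contra xB'; apply: (subsetP sBB').
apply/set1P; rewrite -Ew in_white_neighbors // xB ux andbT /=.
move: wz xW; rewrite !inE => /andP[_ zw] /andP[_ wx].
by rewrite xB (connect_trans zw (induced_connectS sC wx)).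
Qed.

Lemma psd_stepS B B' : psd_step B B' -> B \subset B'.
Proof. by case/existsP=> u /existsP[w /andP[_ /eqP->]]; apply: subsetU1. Qed.

(* Whether all vertices become black does not depend on the run. *)
Lemma psd_zfsP X :
  psd_zfs X <->
  forall B, connect psd_step X B ->
    (forall u w, ~~ psd_force B u w) -> B = [set: T].
Proof.
split=> [/connectP[p] | allX].
  have step_connS B : connect psd_step X B -> X \subset B.
    case/connectP=> q; elim: q X => [|C q IHq] Y /= => [_ -> //|].
    by case/andP=> /psd_stepS YC /IHq{}IHq /IHq; apply: subset_trans.
  move=> Xp Ep B /step_connS XB stall; apply/eqP; rewrite -subTset {}Ep.
  elim: p X XB Xp {step_connS} => [|C p IHp] Y YB //= /andP[YC]; apply: IHp.
  case/existsP: YC => u /existsP[w /andP[uw /eqP->]].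
  rewrite subUset YB sub1set andbT; apply: contraT => wB.
  by have /negP[] := stall u w; apply: psd_force_mono uw wB.
have [B XB maxB] := @arg_maxnP _ X (connect psd_step X) (fun B => #|B|) (connect0 _ X).
rewrite /psd_zfs -(allX B) // => u w; apply/negP => uw.
have wB : w \notin B.
  case/andP: uw => _ /exists_inP[_ /imsetP[z _ ->]] /andP[].
  by rewrite !inE => /andP[].
have Xw : connect psd_step X (w |: B).
  apply: connect_trans XB (connect1 _).
  by apply/existsP; exists u; apply/existsP; exists w; rewrite uw eqxx.
by have := maxB _ Xw; rewrite cardsU1 wB /= ltnn.
Qed.

End PsdZeroForcing.

(* Main.v *)
(** An OS-set read backwards is a chronological list of forces: with
    [A] the set of the first [k] entries, the vertex [w] required by the
    definition of an OS-set for the last of them, [v], is exactly a black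
    vertex that forces [v] when [A] is the set of white vertices.  Hence
    adding a vertex at the end of an OS-set corresponds to prepending a step
    to a complete run of the color change process. *)
Require Import Defs.
From mathcomp Require Import all_boot.

Section OSForcing.

Variables (T : finType) (e : rel T).
Hypothesis e_sym : symmetric e.
Implicit Types (A B X : {set T}) (s : seq T).

(** Symmetry of [e] makes connectivity an equivalence, so any member can represent its component. *)
Lemma component_eq A x y : y \in component e A x -> component e A x = component e A y.
Proof.
rewrite inE => /andP[_ xy]; apply/setP => z; rewrite !inE.
have csym : connect_sym (induced e A).
  by apply: sym_connect_sym => u v; rewrite /induced /= e_sym andbCA.
by rewrite (same_connect csym xy).
Qed.

Lemma psd_force_white B u w : psd_force e B u w -> w \notin B.
Proof.
case/andP=> _ /exists_inP[_ /imsetP[z _ ->] /andP[]].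
by rewrite !inE => /andP[].
Qed.

(** The only white component that can witness a force of [v] is that of [v] itself, so the
    quantifier over components disappears and the OS condition at [v] remains. *)
Lemma psd_force_setC A u v : v \in A ->
  psd_force e (~: A) u v =
  [&& u \notin A, e u v & [forall x in component e A v, (x != v) ==> ~~ e u x]].
Proof.
move=> vA; rewrite /psd_force setCK inE.
case uA: (u \in A) => //=.
have uB : u \in ~: A by rewrite inE uA.
have vv : v \in component e A v by rewrite inE vA connect0.
apply/exists_inP/andP => [[_ /imsetP[z _ ->] /andP[vz /eqP Ew]] | [uv /forall_inP uNx]].
  rewrite (component_eq _ _ _ vz) in Ew.
  have := set11 v; rewrite -Ew in_white_neighbors // => /and3P[_ _ uv].
  split=> //; apply/forall_inP => x xv.
  apply/implyP; apply: contraNN => ux; rewrite -in_set1 -Ew.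
  by rewrite in_white_neighbors // xv ux in_setC; move: xv; rewrite inE => /andP[->].
exists (component e A v); first exact: imset_f.
rewrite vv; apply/eqP/setP => x; rewrite in_white_neighbors // in_setC negbK in_set1.
apply/and3P/eqP => [[_ xv ux] | ->]; last by [].
by apply: contraTeq ux => xv'; apply: (implyP (uNx x xv)).
Qed.

(** The condition at an index below [size s] reads only a prefix of [s], so appending [v] leaves it
    intact; the one new condition is at the last index, where the prefix is the whole sequence. *)
Lemma OS_set_rcons s v :
  OS_set e (rcons s v) =
  [&& OS_set e s, v \notin s
    & [exists w, psd_force e (~: [set x in rcons s v]) w v]].
Proof.
have -> : [exists w, psd_force e (~: [set x in rcons s v]) w v] =
  [exists w, [&& w \notin [set x in rcons s v], e w v
    & [forall x in component e [set x in rcons s v] v, (x != v) ==> ~~ e w x]]].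
  by apply: eq_existsb => w; rewrite psd_force_setC // inE mem_rcons mem_head.
apply/idP/idP.
  rewrite /OS_set rcons_uniq => /andP[/andP[-> ->] /forallP Os] /=.
  apply/andP; split.
    apply/forallP => k.
    have kP : k < size (rcons s v) by rewrite size_rcons ltnS ltnW.
    have := Os (Ordinal kP); rewrite !(tnth_nth v) /= nth_rcons ltn_ord.
    by rewrite -cats1 takel_cat.
  have kP : size s < size (rcons s v) by rewrite size_rcons.
  have := Os (Ordinal kP); rewrite !(tnth_nth v) /= nth_rcons ltnn eqxx.
  by rewrite take_oversize // size_rcons.
case/and3P=> /andP[Us /forallP Os] vs Ov.
rewrite /OS_set rcons_uniq vs Us; apply/forallP => -[k kP].
rewrite !(tnth_nth v) /=; move: (kP); rewrite size_rcons ltnS leq_eqVlt.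
case/predU1P => [-> | ks].
  by rewrite nth_rcons ltnn eqxx take_oversize // size_rcons.
have := Os (Ordinal ks); rewrite !(tnth_nth v) /= nth_rcons ks.
by rewrite -cats1 takel_cat.
Qed.

Lemma OS_set_psd_zfs s : OS_set e s -> psd_zfs e (~: [set x in s]).
Proof.
elim/last_ind: s => [_ | s v IHs].
  rewrite (_ : ~: _ = [set: T]); first exact: psd_zfs_setT.
  by apply/setP => x; rewrite !inE.
(* The last entry [v] is forced first, which leaves exactly the entries of [s] white. *)
rewrite OS_set_rcons => /and3P[/IHs zs vs /existsP[w wv]].
apply: connect_trans zs; apply/connect1/existsP; exists w; apply/existsP.
exists v; rewrite wv; apply/eqP/setP => x; rewrite !inE mem_rcons inE.
by case: eqP => [-> | _]; rewrite ?vs.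
Qed.

Lemma psd_zfs_OS_set X : psd_zfs e X -> exists s, s =i ~: X /\ OS_set e s.
Proof.
case/connectP=> p; elim: p X => [|C p IHp] X /=.
  by move=> _ <-; exists [::]; split=> [x|]; [rewrite !inE | apply/forallP => -[]].
case/andP=> /existsP[u /existsP[w /andP[uw /eqP->]]] wp /(IHp _ wp)[s [Es Os]].
have wX := psd_force_white _ _ _ uw.
(* The induction follows the run, so [w], forced first, goes after all vertices forced later. *)
have Er : rcons s w =i ~: X.
  move=> x; rewrite mem_rcons inE Es !inE.
  by case: eqP => [-> | _]; rewrite ?wX.
exists (rcons s w); split=> //; rewrite OS_set_rcons Os Es !inE eqxx /=.
apply/existsP; exists u; rewrite (_ : ~: _ = X) //.
by apply/setP => x; rewrite !inE Er inE negbK.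
Qed.

End OSForcing.

Theorem theorem3p6 (T : finType) (e : rel T)
    (e_sym : symmetric e) (e_irr : irreflexive e) (T_gt0 : 0 < #|T|) :
  [/\ forall s : seq T, OS_set e s -> psd_zfs e (~: [set x in s]),
      forall X : {set T}, psd_zfs e X ->
        exists s : seq T, s =i ~: X /\ OS_set e s
    & Zplus e + OS e = #|T|].
Proof.
split; [exact: OS_set_psd_zfs | exact: psd_zfs_OS_set |].
have [[X zX cX] minZ] := ZplusP e; have [[s Os sz] maxOS] := OS_P e.
apply/eqP; rewrite eqn_leq; apply/andP; split.
  (* [Zplus e + OS e <= #|T|]: the complement of a longest OS-set is a forcing set. *)
  have /andP[/card_uniqP Us _] := Os.
  rewrite -sz -Us -(cardsE (mem s)) addnC -(cardsC [set x in s]) leq_add2l.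
  exact/minZ/OS_set_psd_zfs.
(* Conversely, the complement of a minimum forcing set, suitably ordered, has length at most
   [OS e]. *)
have [t [Et Ot]] := psd_zfs_OS_set _ _ e_sym _ zX.
have /andP[/card_uniqP Ut _] := Ot.
by rewrite -cX -(cardsC X) leq_add2l -(eq_card Et) Ut maxOS.
Qed.
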